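(* Let $A$ be a unital commutative $\mathbb{R}$-algebra, let $M$ be an Archimedean quadratic module of $A$, and let $\varphi$ be the finest locally convex topology on $A$. Then the closure of $M$ with respect to $\varphi$ equals the closure of $M$ with respect to the topology of $\|\cdot\|_M$: $$\overline{M}^{\varphi}=\overline{M}^{\|\cdot\|_M}.$$
   Context: Real numbers are regarded as elements of $A$ via $r\mapsto r\cdot 1$. A cone of $A$ is a set $C\subseteq A$ with $C+C\subseteq C$ and $\mathbb{R}_{\ge0}\cdot C\subseteq C$. A quadratic module of $A$ is a cone $M$ containing $0$ and $1$ which is closed under multiplication by sums of squares, i.e. $\sum A^2\cdot M\subseteq M$. A cone $C$ is Archimedean if for every $a\in A$ there exists $r\in\mathbb{R}_{\ge0}$ such that $r+a\in C$ and $r-a\in C$. For an Archimedean quadratic module $M$ and $a\in A$, $\|a\|_M:=\inf\{r\in\mathbb{R} : r+a\in M \text{ and } r-a\in M\}$; this is a submultiplicative seminorm on $A$. *)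

(* Defs.v *)
From HB Require Import structures.
From mathcomp Require Import all_boot all_order all_algebra finmap.
From mathcomp Require Import all_classical all_reals all_analysis.

Set Implicit Arguments.
Unset Strict Implicit.
Unset Printing Implicit Defensive.

Import Order.TTheory GRing.Theory Num.Theory.
Import numFieldNormedType.Exports.

Local Open Scope classical_set_scope.
Local Open Scope ring_scope.
Local Open Scope convex_scope.

Section QuadraticModules.
Context (R : realType) (A : comAlgType R).
Implicit Types (C M : set A) (a : A).

Definition cone C :=
  (forall a b, C a -> C b -> C (a + b)) /\
  (forall (r : R) a, 0 <= r -> C a -> C (r *: a)).

Definition sum_of_squares a := exists s : seq A, a = \sum_(b <- s) b ^+ 2.

Definition quadratic_module M :=
  [/\ cone M, M 0, M 1 &
      forall s m, sum_of_squares s -> M m -> M (s * m)].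

Definition is_archimedean C :=
  forall a, exists2 r : R, 0 <= r & C (r%:A + a) /\ C (r%:A - a).

(* [inf] is real-valued, with value 0 on a set that is not bounded below. For
   an Archimedean quadratic module this happens only when -1 \in M, that is,
   when M is the whole algebra. *)
Definition qm_norm M a : R :=
  inf [set r : R | M (r%:A + a) /\ M (r%:A - a)].

End QuadraticModules.

(* The vector space [A] with the topology whose open sets are those containing
   an open [q]-ball around each of their points. For a seminorm [q] this is its
   usual topology; the axioms of a topology hold for an arbitrary [q]. *)
Definition seminorm_topology (R : realType) (A : lmodType R) (q : A -> R) : Type
  := A.

Section SeminormTopology.
Context (R : realType) (A : lmodType R) (q : A -> R).

Definition seminorm_open (U : set A) :=
  forall x, U x -> exists2 e : R, 0 < e & [set y | q (y - x) < e] `<=` U.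

Lemma seminorm_openT : seminorm_open setT.
Proof. by move=> x _; exists 1. Qed.

Lemma seminorm_openI : setI_closed seminorm_open.
Proof.
move=> U V oU oV x [/oU[e e0 eU] /oV[d d0 dV]].
exists (Num.min e d); first by rewrite lt_min e0.
by move=> y /=; rewrite lt_min => /andP[ye yd]; split; [exact: eU|exact: dV].
Qed.

Lemma seminorm_open_bigU (I : Type) (f : I -> set A) :
  (forall i, seminorm_open (f i)) -> seminorm_open (\bigcup_i f i).
Proof.
move=> of_ x [i _ /of_[e e0 eU]]; exists e => // y ye.
by exists i => //; exact: eU.
Qed.

HB.instance Definition _ := GRing.Lmodule.copy (seminorm_topology q) A.
HB.instance Definition _ := @isOpenTopological.Build (seminorm_topology q)
  seminorm_open seminorm_openT seminorm_openI seminorm_open_bigU.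

End SeminormTopology.

(* A locally convex topology on the vector space [A], presented by a linear
   isomorphism of [A] onto a locally convex topological vector space. *)
Record lc_topology (R : realType) (A : lmodType R) := LcTopology {
  lc_space : tvsType R ;
  lc_iso : {linear A -> lc_space} ;
  lc_iso_bij : bijective lc_iso
}.

Definition lc_open (R : realType) (A : lmodType R) (t : lc_topology A) :
    set_system A :=
  [set lc_iso t @^-1` V | V in open].

(* The vector space [A] with the supremum of all its locally convex topologies.
   It is shown below to be locally convex itself, hence to be the finest one. *)
Definition finest_lc (R : realType) (A : lmodType R) : Type := A.

Section FinestLocallyConvex.
Context (R : realType) (A : lmodType R).
Local Notation S := (finest_lc A).

HB.instance Definition _ := GRing.Lmodule.copy S A.
HB.instance Definition _ := @isSubBaseTopological.Build S
  (set A) [set U | exists t : lc_topology A, lc_open t U] id.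

Lemma finest_lc_iso_continuous (t : lc_topology A) :
  continuous (lc_iso t : S -> lc_space t).
Proof.
apply/continuousP => V oV.
exists [set lc_iso t @^-1` V]; last by rewrite bigcup_set1.
move=> _ ->; exists [fset (lc_iso t @^-1` V : set A)]%fset.
  by move=> U /fset1P ->; rewrite inE; exists t, V.
by rewrite bigcap_fset big_seq_fset1.
Qed.

Lemma finest_lc_cvg (F : set_system S) (x : S) : Filter F ->
  (forall t : lc_topology A, lc_iso t @ F --> lc_iso t x) -> F --> x.
Proof.
move=> FF Fx N; rewrite nbhsE => -[_ [[B sB <-] [C BC Cx]] sBN].
rewrite nbhs_filterE; apply: filterS sBN _.
apply: (@filterS _ _ _ C); first by move=> y Cy; exists C.
have [D sD DC] := sB _ BC.
rewrite -DC; apply: filter_bigI => U DU.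
have := sD _ DU; rewrite inE => -[t [V oV VU]].
rewrite /= -VU; apply: (Fx t V); apply: open_nbhs_nbhs; split => //.
by move: Cx; rewrite -DC => /(_ _ DU); rewrite /= -VU.
Qed.

Lemma finest_lc_continuous (T : topologicalType) (f : T -> S) :
  (forall t : lc_topology A, continuous (lc_iso t \o f)) -> continuous f.
Proof.
by move=> cf x; apply: finest_lc_cvg => t; apply: cvg_trans (cf t x).
Qed.

Let finest_lc_add_continuous : continuous (fun x : S * S => x.1 + x.2).
Proof.
apply: finest_lc_continuous => t x.
rewrite (_ : _ \o _ = fun y : S * S => lc_iso t y.1 + lc_iso t y.2); last first.
  by apply/funext => y /=; exact: (linearD (lc_iso t)).
apply: (@continuous_comp _ _ _
  (fun y : S * S => (lc_iso t y.1, lc_iso t y.2))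
  (fun z : lc_space t * lc_space t => z.1 + z.2)); last exact: add_continuous.
apply: cvg_pair.
- exact: (continuous_comp cvg_fst (@finest_lc_iso_continuous t _)).
- exact: (continuous_comp cvg_snd (@finest_lc_iso_continuous t _)).
Qed.

Let finest_lc_scale_continuous : continuous (fun z : R^o * S => z.1 *: z.2).
Proof.
apply: finest_lc_continuous => t x.
rewrite (_ : _ \o _ = fun y : R^o * S => y.1 *: lc_iso t y.2); last first.
  by apply/funext => y /=; exact: linearZZ.
apply: (@continuous_comp _ _ _ (fun y : R^o * S => (y.1, lc_iso t y.2))
  (fun z : R^o * lc_space t => z.1 *: z.2)); last exact: scale_continuous.
apply: (@cvg_pair _ _ _ _ (nbhs (x.1 : R^o))); first exact: cvg_fst.
exact: (continuous_comp cvg_snd (@finest_lc_iso_continuous t _)).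
Qed.

Let finest_lc_locally_convex :
  exists2 B : set_system S, (forall b, b \in B -> convex_set b) & basis B.
Proof.
pose B : set_system S := [set U | open U /\ convex_set U].
exists B; first by move=> U; rewrite inE => -[].
split; first by move=> U [].
move=> x.
pose G := filter_from [set U | B U /\ U x] id.
have FG : Filter G.
  apply: filter_from_filter.
    by exists setT; split => //; split; [exact: openT|move=> *; rewrite inE].
  move=> U V [[oU cU] Ux] [[oV cV] Vx]; exists (U `&` V) => //.
  split=> //; split; first exact: openI.
  move=> y z l; rewrite !inE => -[Uy Vy] [Uz Vz]; split.
  - by apply/set_mem/cU; exact/mem_set.
  - by apply/set_mem/cV; exact/mem_set.
suff GN : G --> x by move=> N /GN [U [BU Ux] UN]; exists U.
apply: finest_lc_cvg => t N tN.
have [D cD [oD bD]] := @locally_convex R (lc_space t).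
have [V [DV Vx] VN] := bD _ _ tN.
exists (lc_iso t @^-1` V); last by move=> y /VN.
split=> //; split.
  by move/continuousP: (@finest_lc_iso_continuous t); apply; exact: oD.
move=> y z l; rewrite !inE => Vy Vz.
rewrite /= [X in V X](_ : _ = (lc_iso t y : convex_lmodType (lc_space t)) <| l |>
   (lc_iso t z : convex_lmodType (lc_space t))).
  by apply/set_mem; apply: (cD V (mem_set DV)); exact/mem_set.
rewrite (linearD (lc_iso t)).
by rewrite !linearZZ.
Qed.

(* the factory below only provides the uniform structure *)
HB.instance Definition _ := PreTopologicalLmod_isTvs.Build R S
  finest_lc_add_continuous finest_lc_scale_continuous finest_lc_locally_convex.
HB.instance Definition _ :=
  PreTopologicalNmodule_isTopologicalNmodule.Build S finest_lc_add_continuous.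
HB.instance Definition _ :=
  TopologicalNmodule_isTopologicalLmodule.Build R S finest_lc_scale_continuous.
HB.instance Definition _ := Uniform_isTvs.Build R S finest_lc_locally_convex.

End FinestLocallyConvex.

Section FinestLocallyConvexSpec.
Context (R : realType) (A : lmodType R).

Definition finest_lc_topology : lc_topology A :=
  @LcTopology R A (finest_lc A) (idfun : {linear A -> A})
    (@Bijective _ _ idfun idfun (frefl _) (frefl _)).

Lemma finest_lc_topologyE : lc_open finest_lc_topology = @open (finest_lc A).
Proof. by apply/seteqP; split => U; [case=> V oV <-|exists U]. Qed.

Lemma finest_lc_topology_max (t : lc_topology A) :
  lc_open t `<=` lc_open finest_lc_topology.
Proof.
rewrite finest_lc_topologyE => _ [V oV <-].
by move/continuousP: (@finest_lc_iso_continuous R A t); apply.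
Qed.

End FinestLocallyConvexSpec.

(* Main.v *)
Require Import Defs.
From HB Require Import structures.
From mathcomp Require Import all_boot all_order all_algebra.
From mathcomp Require Import all_classical all_reals all_analysis.
From mathcomp Require Import ring lra.

(** Only the cone structure of [M] and the order unit 1 matter. If [x] is in the
    [qm_norm M]-closure of [M], then [x + e] is in [M] for every [e > 0], and
    [x + e] tends to [x] in every vector space topology. Conversely, [qm_norm M]
    is a seminorm unless [-1] is in [M], in which case [M] is everything; the
    topology of a seminorm is locally convex, hence coarser than the finest
    one. *)

Import Order.TTheory GRing.Theory Num.Theory.
Import numFieldNormedType.Exports.

Local Open Scope classical_set_scope.
Local Open Scope ring_scope.

(** Homogeneity is only asked as an inequality: for [c != 0] the reverse one follows by scaling back
    with [c^-1], and for [c = 0] from nonnegativity. *)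
Record seminorm {R : realType} (A : lmodType R) := Seminorm {
  seminorm_fun :> A -> R ;
  seminormD : forall x y, seminorm_fun (x + y) <= seminorm_fun x + seminorm_fun y ;
  seminormZ_le : forall c x, seminorm_fun (c *: x) <= `|c| * seminorm_fun x
}.
Arguments seminormD {R A} s x y.
Arguments seminormZ_le {R A} s c x.

(* A key on which the topological vector space structure can be declared: over
   an arbitrary function [seminorm_topology] only carries a topology. *)
Definition seminorm_space {R : realType} {A : lmodType R} (q : seminorm A) :
  Type := seminorm_topology q.

(** * The locally convex topology of a seminorm *)

Section SeminormSpace.
Context (R : realType) (A : lmodType R) (q : seminorm A).
Local Notation S := (seminorm_space q).

HB.instance Definition _ := GRing.Lmodule.copy S A.
HB.instance Definition _ := Topological.copy S (seminorm_topology q).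

Lemma seminorm0_le : q 0 <= 0.
Proof. by have := seminormZ_le q 0 0; rewrite scale0r normr0 mul0r. Qed.

Lemma seminormN_le x : q (- x) <= q x.
Proof. by have := seminormZ_le q (-1) x; rewrite scaleN1r normrN1 mul1r. Qed.

Lemma seminorm_ge0 x : 0 <= q x.
Proof.
(* Subadditivity at [0 + 0] gives [0 <= q 0]; then [q 0 <= q x + q (- x) <= 2 * q x]. *)
have := seminormD q (x - x) 0; have := seminormD q x (- x).
rewrite addr0 subrr; have := seminormN_le x; lra.
Qed.

Lemma seminorm_ball_open (x : S) (e : R) : open [set y : S | q (y - x) < e].
Proof.
move=> y /= ye; exists (e - q (y - x)); first by rewrite subr_gt0.
move=> z /= zy; rewrite -(subrKA y z (- x)).
by apply: le_lt_trans (seminormD q _ _) _; rewrite -ltrBrDr.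
Qed.

Lemma seminorm_nbhsP (x : S) (N : set S) :
  nbhs x N <-> exists2 e : R, 0 < e & [set y | q (y - x) < e] `<=` N.
Proof.
split.
  rewrite nbhsE => -[U [oU Ux] UN]; have [e e0 eU] := oU _ Ux.
  by exists e => // y /eU /UN.
move=> [e e0 eN]; apply: filterS eN _; apply: open_nbhs_nbhs; split.
  exact: seminorm_ball_open.
by rewrite /= subrr; apply: le_lt_trans seminorm0_le _.
Qed.

Lemma seminorm_add_continuous : continuous (fun x : S * S => x.1 + x.2).
Proof.
move=> [x y] N /seminorm_nbhsP[e e0 eN].
exists ([set z : S | q (z - x) < e / 2], [set z : S | q (z - y) < e / 2]).
  by split; apply/seminorm_nbhsP; exists (e / 2) => //; rewrite divr_gt0.
move=> [u v] [/= ux vy]; apply: eN => /=.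
rewrite opprD addrACA.
by apply: le_lt_trans (seminormD q _ _) _; lra.
Qed.

Lemma seminorm_scale_continuous : continuous (fun z : R^o * S => z.1 *: z.2).
Proof.
move=> [c x] N /seminorm_nbhsP[e e0 eN].
(* The radii make both terms of [u *: (v - x) + (u - c) *: x] small. The bound 1 in [d'] ensures
   [|u| <= |c| + 1], and the 1 in [q x + 1] keeps the denominator positive. *)
pose d := e / 2 / (`|c| + 1); pose d' := Num.min 1 (e / 2 / (q x + 1)).
have q0 := seminorm_ge0 x; have c0 := normr_ge0 c.
have d0 : 0 < d by rewrite !divr_gt0 //; lra.
have d'0 : 0 < d' by rewrite lt_min ltr01 /= !divr_gt0 //; lra.
exists ([set u : R^o | `|c - u| < d'], [set z : S | q (z - x) < d]).
  split; last by apply/seminorm_nbhsP; exists d.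
  exact: (@nbhsx_ballx R R^o c d').
move=> [u v] [/= uc vx]; apply: eN => /=.
have -> : u *: v - c *: x = u *: (v - x) + (u - c) *: x :> A.
  by rewrite scalerBr scalerBl addrA subrK.
apply: le_lt_trans (seminormD q _ _) _.
have h1 := seminormZ_le q u (v - x).
have h2 := seminormZ_le q (u - c) x.
move: uc; rewrite distrC lt_min => /andP[uc1 uc2].
have uc : `|u| <= `|c| + 1.
  by have := ler_normD c (u - c); rewrite subrKC; lra.
have k1 : `|u| * q (v - x) < e / 2.
  apply: (@le_lt_trans _ _ ((`|c| + 1) * q (v - x))).
    by rewrite ler_wpM2r // seminorm_ge0.
  by rewrite mulrC -ltr_pdivlMr //; lra.
have k2 : `|u - c| * q x <= e / 2.
  apply: (@le_trans _ _ (`|u - c| * (q x + 1))).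
    by rewrite ler_wpM2l //; lra.
  by rewrite -ler_pdivlMr ?ltW //; lra.
lra.
Qed.

Lemma seminorm_locally_convex :
  exists2 B : set_system S, (forall b, b \in B -> convex_set b) & basis B.
Proof.
exists [set U | exists (x : S) (e : R), U = [set y | q (y - x) < e]].
  move=> U /set_mem[x [e ->]]; apply/convex_setW => y z.
  move=> /set_mem /= ye /set_mem /= ze l t0 t1; apply/mem_set.
  set t := l%:num in t0 t1.
  change (q ((t *: y + (1 - t) *: z) - x : A) < e).
  have -> : (t *: y + (1 - t) *: z) - x = t *: (y - x) + (1 - t) *: (z - x) :> A.
    by rewrite !scalerBr addrACA -opprD -scalerDl subrKC scale1r.
  apply: le_lt_trans (seminormD q _ _) _.
  have := seminormZ_le q t (y - x); have := seminormZ_le q (1 - t) (z - x).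
  by rewrite !gtr0_norm ?subr_gt0 //; nra.
split=> [U [x [e ->]]|x N /seminorm_nbhsP[e e0 eN]].
  exact: seminorm_ball_open.
exists [set y | q (y - x) < e] => //; split; first by exists x, e.
by rewrite /= subrr; apply: le_lt_trans seminorm0_le _.
Qed.

HB.instance Definition _ := PreTopologicalLmod_isTvs.Build R S
  seminorm_add_continuous seminorm_scale_continuous seminorm_locally_convex.
HB.instance Definition _ :=
  PreTopologicalNmodule_isTopologicalNmodule.Build S seminorm_add_continuous.
HB.instance Definition _ :=
  TopologicalNmodule_isTopologicalLmodule.Build R S seminorm_scale_continuous.
HB.instance Definition _ := Uniform_isTvs.Build R S seminorm_locally_convex.

Definition seminorm_lc_topology : lc_topology A :=
  @LcTopology R A S (idfun : {linear A -> A})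
    (@Bijective _ _ idfun idfun (frefl _) (frefl _)).

(** The identity of [A] is one of the isomorphisms generating the finest topology, so every seminorm
    neighbourhood of a point is a neighbourhood there too. *)
Lemma closure_finest_lc_sub_seminorm (C : set A) :
  @closure (finest_lc A) C `<=` @closure (seminorm_topology q) C.
Proof.
move=> x Cx N Nx; apply: Cx.
exact: (@finest_lc_iso_continuous R A seminorm_lc_topology x N Nx).
Qed.

End SeminormSpace.

Lemma tvs_line_cvg {R : realType} {T : tvsType R} (x v : T) :
  x + e *: v @[e --> (0 : R^o)] --> x.
Proof.
rewrite -[X in _ --> X]addr0 -(scale0r v).
apply: (@continuous2_cvg _ _ _ _ _ _ _ _ +%R).
- exact: (@add_continuous T (x, 0 *: v)).
- exact: cvg_cst.
apply: (@continuous2_cvg _ R^o _ _ _ _ _ _ ( *:%R)).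
- exact: (@scale_continuous R T (0, v)).
- exact: cvg_id.
exact: cvg_cst.
Qed.

(** * The order unit seminorm of an Archimedean cone *)

Section ConeNorm.
Context (R : realType) (A : comAlgType R) (M : set A).
Hypotheses (coneM : cone M) (M1 : M 1) (archM : is_archimedean M).

Local Notation bounds a := [set r : R | M (r%:A + a) /\ M (r%:A - a)].

Lemma cone_scalar (r : R) : 0 <= r -> M r%:A.
Proof. by move=> r0; exact: coneM.2. Qed.

Lemma cone_bounds_neq0 a : bounds a !=set0.
Proof. by have [r _ Mr] := archM a; exists r. Qed.

(** For a bound [r < e] of [a - b], the element [b + e] is the sum of [a], [r - (a - b)] and
    [e - r], all in [M]. *)
Lemma cone_norm_lt (a b : A) (e : R) :
  M a -> qm_norm M (a - b) < e -> M (b + e%:A).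
Proof.
move=> Ma /inf_lt -/(_ (cone_bounds_neq0 _))[r [_ Mr] re].
have -> : b + e%:A = a + (r%:A - (a - b)) + (e - r)%:A.
  by rewrite scalerBl opprB (addrCA a) subrKC (addrC r%:A) -addrA subrKC.
by apply: coneM.1; [exact: coneM.1|apply: cone_scalar; rewrite subr_ge0 ltW].
Qed.

Section ProperCone.
Hypothesis MN1 : ~ M (- 1).

(** The two memberships add up to [2 * r], which for [r < 0] is a positive multiple of [- 1]. So the
    infimum in [qm_norm] is a genuine one. *)
Lemma cone_bounds_ge0 a (r : R) : M (r%:A + a) -> M (r%:A - a) -> 0 <= r.
Proof.
move=> Mra Mr'; rewrite leNgt; apply/negP => r0; apply: MN1.
have -> : - 1 = (- (2 * r))^-1 *: ((r%:A + a) + (r%:A - a)) :> A.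
  rewrite addrACA subrr addr0 -scalerDl scalerA -[LHS]scaleN1r; congr (_ *: _).
  by field; rewrite lt_eqF.
apply: coneM.2; last exact: coneM.1.
by rewrite invr_ge0; lra.
Qed.

Lemma cone_bounds_has_lbound a : has_lbound (bounds a).
Proof. by exists 0 => r [/cone_bounds_ge0]; apply. Qed.

Lemma qm_normD a b : qm_norm M (a + b) <= qm_norm M a + qm_norm M b.
Proof.
apply/ler_addgt0Pr => e e0; have e20 : 0 < e / 2 by rewrite divr_gt0.
have hi c : has_inf (bounds c).
  by split; [exact: cone_bounds_neq0|exact: cone_bounds_has_lbound].
have [r [Mr Mr'] re] := inf_adherent e20 (hi a).
have [s [Ms Ms'] se] := inf_adherent e20 (hi b).
apply: (@le_trans _ _ (r + s)); last by rewrite /qm_norm; lra.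
apply: ge_inf; first exact: cone_bounds_has_lbound.
by rewrite /= scalerDl opprD; split; rewrite addrACA; exact: coneM.1.
Qed.

Lemma qm_normZ_le c a : qm_norm M (c *: a) <= `|c| * qm_norm M a.
Proof.
have cr r : bounds a r -> qm_norm M (c *: a) <= `|c| * r.
  move=> [Mr Mr']; apply: ge_inf; first exact: cone_bounds_has_lbound.
  have [c0|c0] := leP 0 c.
    rewrite /= ger0_norm // -scalerA -scalerDr -scalerBr.
    by split; exact: coneM.2.
  have nc0 : 0 <= - c by rewrite oppr_ge0 ltW.
  (* A negative scalar exchanges the two membership conditions. *)
  rewrite /= ltr0_norm // -scalerA -{2 4}(opprK c) !(scaleNr (- c)) opprK.
  by rewrite -scalerBr -scalerDr; split; exact: coneM.2.
have [->|c0] := eqVneq c 0; last first.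
  have {}c0 : 0 < `|c| by rewrite normr_gt0.
  rewrite mulrC -ler_pdivrMr //.
  apply: lb_le_inf; first exact: cone_bounds_neq0.
  by move=> r /cr; rewrite ler_pdivrMr // mulrC.
(* For [c = 0] one cannot divide by [|c|], but 0 is itself a bound of the zero vector. *)
rewrite normr0 mul0r scale0r; apply: ge_inf; first exact: cone_bounds_has_lbound.
by rewrite /= scale0r subr0 addr0 -(scale0r 1); split; exact: cone_scalar.
Qed.

Definition qm_seminorm : seminorm A := Seminorm _ _ _ qm_normD qm_normZ_le.

Lemma cone_norm_closure_sub :
  @closure (seminorm_topology (qm_norm M)) M `<=` @closure (finest_lc A) M.
Proof.
move=> x Mx N Nx.
have /nbhs_ballP[e /= e0 eN] := tvs_line_cvg (x : finest_lc A) 1 _ Nx.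
have e20 : 0 < e / 2 by rewrite divr_gt0.
(* The same [e / 2] is the seminorm radius and the shift along 1: [cone_norm_lt] puts [x + e / 2] in
   [M], and [e / 2 < e] keeps it in [N]. *)
have [|a [Ma ax]] := Mx [set a | qm_norm M (a - x) < e / 2].
  by apply/(seminorm_nbhsP _ _ qm_seminorm); exists (e / 2).
exists (x + (e / 2)%:A); split; first exact: cone_norm_lt ax.
apply: (eN (e / 2)).
by rewrite /ball /= sub0r normrN gtr0_norm //; lra.
Qed.

End ProperCone.

(** Any [a] is the sum of some [r + a] in [M] and of [r *: (- 1)]. *)
Lemma improper_cone : M (- 1) -> M = setT.
Proof.
move=> MN1; apply/seteqP; split=> // a _.
have [r r0 [Mra _]] := archM a.
rewrite -(addKr r%:A a) -scalerN addrC; apply: coneM.1 => //.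
exact: coneM.2.
Qed.

End ConeNorm.

Theorem corollary4p3 (R : realType) (A : comAlgType R) (M : set A)
    (qmM : quadratic_module M) (archM : is_archimedean M) :
  @closure (finest_lc A) M = @closure (seminorm_topology (qm_norm M)) M.
Proof.
have [coneM _ M1 _] := qmM.
(* If [- 1] is in [M], then [M] is the whole algebra and so are both closures. *)
have [MN1|MN1] := pselect (M (- 1)).
  rewrite (improper_cone _ _ _ coneM archM MN1).
  by apply/seteqP; split=> x _; exact: subset_closure.
apply/seteqP; split; last exact: cone_norm_closure_sub.
exact: (closure_finest_lc_sub_seminorm _ _ (qm_seminorm _ _ _ coneM M1 archM MN1)).
Qed.
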